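(* Let $\Gamma$ be a Coxeter graph with (finite) vertex set $S$, let $(A,\Sigma)$ be its Artin system, where $\Sigma=\{\sigma_s \mid s\in S\}$, and let $T$ be a subset of $S$. Let $A_T$ be the subgroup of $A$ generated by $\Sigma_T=\{\sigma_s \mid s\in T\}$. Then $A_T$ is a convex subgroup of $A$ with respect to $\Sigma$.
   Context: Coxeter graph. Let $S$ be a finite set. A Coxeter matrix over $S$ is a square matrix $M=(m_{s,t})_{s,t\in S}$ with $m_{s,s}=1$ for all $s\in S$ and $m_{s,t}=m_{t,s}\in\{2,3,4,\dots\}\cup\{\infty\}$ for all $s,t\in S$, $s\neq t$. The Coxeter graph $\Gamma$ of $M$ is the labelled graph with vertex set $S$ in which two vertices $s,t$ are joined by an edge if $m_{s,t}\ge 3$, this edge being labelled by $m_{s,t}$ if $m_{s,t}\ge 4$. (Thus $\Gamma$ and $M$ determine each other.) Artin system. For letters $a,b$ and an integer $m\ge 2$, let $\Pi(a,b:m)$ denote the alternating word $aba\cdots$ of length $m$, i.e. $(ab)^{m/2}$ if $m$ is even and $a(ba)^{(m-1)/2}$ if $m$ is odd. Let $\Sigma=\{\sigma_s\mid s\in S\}$ be an abstract set in one-to-one correspondence with $S$. The Artin system of $\Gamma$ is the pair $(A,\Sigma)$, where $A$ is the group with presentation $$A=\langle \Sigma \mid \Pi(\sigma_s,\sigma_t:m_{s,t})=\Pi(\sigma_t,\sigma_s:m_{s,t}) \text{ for all } s,t\in S,\ s\neq t,\ m_{s,t}\neq\infty\rangle .$$ Convexity. Let $G$ be a group with generating set $R$.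 An expression for $\alpha\in G$ is a word $r_1^{\varepsilon_1}\cdots r_\ell^{\varepsilon_\ell}$ on the alphabet $R\sqcup R^{-1}$ (so $r_i\in R$, $\varepsilon_i\in\{1,-1\}$) which represents $\alpha$. The length $\lg_R(\alpha)$ is the minimal length of an expression for $\alpha$, and a geodesic for $\alpha$ is an expression for $\alpha$ of length $\lg_R(\alpha)$. Let $Q\subset R$ and let $H$ be the subgroup of $G$ generated by $Q$. Then $H$ is called convex in $G$ with respect to $R$ if for all $\alpha\in H$ and all geodesics $r_1^{\varepsilon_1}\cdots r_\ell^{\varepsilon_\ell}$ for $\alpha$ (with respect to $R$), one has $r_1,\dots,r_\ell\in Q$. In the claim this is applied with $G=A$, $R=\Sigma$, $Q=\Sigma_T$, $H=A_T$. *)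

(* Defs.v *)
From HB Require Import structures.
From mathcomp Require Import all_boot.
From mathcomp Require Import boolp classical_sets.

Set Implicit Arguments.
Unset Strict Implicit.
Unset Printing Implicit Defensive.

Local Open Scope classical_set_scope.
Local Open Scope quotient_scope.

(* Words on the alphabet X and its formal inverses: the letter (x, true)
   stands for x and (x, false) for x^-1. *)
Definition gword (X : Type) := seq (X * bool).

Section WordValue.
Local Open Scope group_scope.
Context (X : Type) (G : groupType) (f : X -> G).

Definition gletter_val (l : X * bool) : G := if l.2 then f l.1 else (f l.1)^-1.

Definition gword_val (w : gword X) : G := \prod_(l <- w) gletter_val l.

Lemma gword_val_cat u v : gword_val (u ++ v) = gword_val u * gword_val v.
Proof. exact: big_cat. Qed.

Lemma gword_val1 x b : gword_val [:: (x, b)] = if b then f x else (f x)^-1.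
Proof. exact: big_seq1. Qed.
End WordValue.

Section Presentation.
Context (X : choiceType) (rels : gword X -> gword X -> Prop).

(* Two words are identified when they represent the same element of the group
   < X | u = v for all (u, v) in rels >. *)
Inductive pres_eq : gword X -> gword X -> Prop :=
| PresRefl u : pres_eq u u
| PresSym u v : pres_eq u v -> pres_eq v u
| PresTrans u v w : pres_eq u v -> pres_eq v w -> pres_eq u w
| PresCat u u' v v' : pres_eq u u' -> pres_eq v v' -> pres_eq (u ++ v) (u' ++ v')
| PresCancel x b : pres_eq [:: (x, b); (x, ~~ b)] [::]
| PresRel u v : rels u v -> pres_eq u v.

Definition pres_eqb (u v : gword X) : bool := `[< pres_eq u v >].

Fact pres_eqb_refl : reflexive pres_eqb.
Proof. by move=> u; apply/asboolP; apply: PresRefl. Qed.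

Fact pres_eqb_sym : symmetric pres_eqb.
Proof. by move=> u v; apply/asboolP/asboolP; apply: PresSym. Qed.

Fact pres_eqb_trans : transitive pres_eqb.
Proof.
by move=> v u w /asboolP uv /asboolP vw; apply/asboolP; apply: PresTrans uv vw.
Qed.

Canonical pres_equiv :=
  EquivRel pres_eqb pres_eqb_refl pres_eqb_sym pres_eqb_trans.

Definition presented := {eq_quot pres_equiv}.

HB.instance Definition _ := Choice.on presented.

Definition pres_class (w : gword X) : presented := \pi_{eq_quot pres_equiv} w.

Lemma pres_classP u v : pres_class u = pres_class v <-> pres_eq u v.
Proof.
split=> [/eqmodP/asboolP //|uv].
by apply/eqmodP/asboolP.
Qed.

Lemma pres_class_surj (a : presented) : exists w, a = pres_class w.
Proof. by exists (repr (a : {eq_quot pres_equiv})); rewrite /pres_class reprK. Qed.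

Definition gword_inv (w : gword X) : gword X :=
  rev [seq (l.1, ~~ l.2) | l <- w].

Lemma gword_invK : involutive gword_inv.
Proof.
move=> w; rewrite /gword_inv map_rev revK -map_comp -[RHS]map_id.
by apply: eq_map => -[x b] /=; rewrite negbK.
Qed.

Lemma gword_inv_cat u v : gword_inv (u ++ v) = gword_inv v ++ gword_inv u.
Proof. by rewrite /gword_inv map_cat rev_cat. Qed.

Lemma gword_inv_cons l w : gword_inv (l :: w) = gword_inv w ++ [:: (l.1, ~~ l.2)].
Proof. by rewrite -cat1s gword_inv_cat. Qed.

Lemma pres_mulwV w : pres_eq (w ++ gword_inv w) [::].
Proof.
elim: w => [|[x b] w IHw]; first exact: PresRefl.
rewrite gword_inv_cons -cat1s -catA [w ++ _]catA.
apply: PresTrans (PresCancel x b).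
apply: (@PresCat [:: _] [:: _]); first exact: PresRefl.
rewrite -[in X in pres_eq _ X](cat0s [:: _]).
by apply: PresCat; [exact: IHw | exact: PresRefl].
Qed.

Lemma pres_mulVw w : pres_eq (gword_inv w ++ w) [::].
Proof. by rewrite -{2}[w]gword_invK; apply: pres_mulwV. Qed.

Lemma pres_inv u v : pres_eq u v -> pres_eq (gword_inv u) (gword_inv v).
Proof.
move=> uv; apply: (@PresTrans _ (gword_inv u ++ (v ++ gword_inv v))).
  rewrite -[X in pres_eq X _]cats0.
  by apply: PresCat (PresRefl _) (PresSym (pres_mulwV v)).
rewrite catA -[X in pres_eq _ X]cat0s.
apply: PresCat (PresRefl _).
apply: PresTrans (pres_mulVw u).
exact: PresCat (PresRefl _) (PresSym uv).
Qed.

Let wrepr (a : presented) : gword X := repr (a : {eq_quot pres_equiv}).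

Let wreprK a : pres_class (wrepr a) = a.
Proof. by rewrite /pres_class /wrepr reprK. Qed.

Let class_wrepr w : pres_eq (wrepr (pres_class w)) w.
Proof. by apply/pres_classP; rewrite wreprK. Qed.

Definition pres_one : presented := pres_class [::].
Definition pres_mul (a b : presented) : presented :=
  pres_class (wrepr a ++ wrepr b).
Definition pres_invg (a : presented) : presented :=
  pres_class (gword_inv (wrepr a)).

Lemma pres_mulE u v :
  pres_mul (pres_class u) (pres_class v) = pres_class (u ++ v).
Proof. by apply/pres_classP; apply: PresCat; apply: class_wrepr. Qed.

Lemma pres_invgE u : pres_invg (pres_class u) = pres_class (gword_inv u).
Proof. by apply/pres_classP; apply: pres_inv; apply: class_wrepr. Qed.

Fact pres_mulA : associative pres_mul.
Proof.
by move=> a b c; rewrite -[a]wreprK -[b]wreprK -[c]wreprK !pres_mulE catA.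
Qed.

Fact pres_mul1 : left_id pres_one pres_mul.
Proof. by move=> a; rewrite -[a]wreprK pres_mulE. Qed.

Fact pres_mulr1 : right_id pres_one pres_mul.
Proof. by move=> a; rewrite -[a]wreprK pres_mulE cats0. Qed.

Fact pres_mulV : left_inverse pres_one pres_invg pres_mul.
Proof.
move=> a; rewrite -[a]wreprK pres_invgE pres_mulE.
by apply/pres_classP; apply: pres_mulVw.
Qed.

Fact pres_mulrV : right_inverse pres_one pres_invg pres_mul.
Proof.
move=> a; rewrite -[a]wreprK pres_invgE pres_mulE.
by apply/pres_classP; apply: pres_mulwV.
Qed.

HB.instance Definition _ := isGroup.Build presented
  pres_mulA pres_mul1 pres_mulr1 pres_mulV pres_mulrV.

Definition pres_gen (x : X) : presented := pres_class [:: (x, true)].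

Lemma pres_classE w : pres_class w = gword_val pres_gen w.
Proof.
elim: w => [|[x b] w IHw]; first by rewrite /gword_val big_nil.
rewrite -cat1s -pres_mulE gword_val_cat gword_val1 -IHw; congr pres_mul.
by case: b => //; rewrite [RHS]pres_invgE.
Qed.

Lemma pres_universal (G : groupType) (f : X -> G) :
  (forall u v, rels u v -> gword_val f u = gword_val f v) ->
  exists2 h : presented -> G,
    (forall x, h (pres_gen x) = f x) & {morph h : a b / (a * b)%g}.
Proof.
move=> frels.
have val_eq u v : pres_eq u v -> gword_val f u = gword_val f v.
  elim=> {u v} [//|u v _ -> //|u v w _ -> _ -> //|u u' v v' _ E _ E'|x b|].
  - by rewrite !gword_val_cat E E'.
  - rewrite -cat1s gword_val_cat !gword_val1 /gword_val big_nil.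
    by case: b; rewrite /= ?mulgV ?mulVg.
  - exact: frels.
exists (fun a => gword_val f (wrepr a)) => [x|a b].
  by rewrite (val_eq _ _ (class_wrepr _)) gword_val1.
rewrite -gword_val_cat; apply: val_eq; exact: class_wrepr.
Qed.
End Presentation.

(* The entry None stands for infinity.  The Coxeter graph and the Coxeter
   matrix determine each other, so a Coxeter graph with vertex set S is
   represented by its matrix: s and t are joined by an edge when the entry
   at (s, t) is at least 3, and this entry is the label. *)
Record coxeterMatrix (S : finType) := CoxeterMatrix {
  coxeter_entry :> S -> S -> option nat;
  coxeter_diag : forall s, coxeter_entry s s = Some 1;
  coxeter_sym : forall s t, coxeter_entry s t = coxeter_entry t s;
  coxeter_ge2 : forall s t m, s != t -> coxeter_entry s t = Some m -> 2 <= m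
}.

Definition alternating (X : Type) (a b : X) (m : nat) : gword X :=
  mkseq (fun i => (if odd i then b else a, true)) m.

Inductive artin_rel (S : finType) (M : coxeterMatrix S) :
  gword S -> gword S -> Prop :=
| ArtinRel s t m : s != t -> M s t = Some m ->
    artin_rel M (alternating s t m) (alternating t s m).

Definition artin (S : finType) (M : coxeterMatrix S) : groupType :=
  presented (artin_rel M).

Definition artin_gen (S : finType) (M : coxeterMatrix S) (s : S) : artin M :=
  pres_gen (artin_rel M) s.

Section Convexity.
Local Open Scope group_scope.
Context (G : groupType).
Implicit Types (R Q H : set G) (a : G) (w : gword G).

Definition is_subgroup H : Prop :=
  [/\ H 1, forall x y, H x -> H y -> H (x * y) & forall x, H x -> H x^-1].

Definition generated Q : set G := smallest is_subgroup Q.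

Definition expression R a w : Prop :=
  (forall l, l \in w -> R l.1) /\ gword_val id w = a.

(* The junk value 0 is used only when a has no expression on R, hence never
   when R generates G; it does not affect the notion of geodesic. *)
Definition lg R a : nat :=
  if pselect (exists n, `[< exists2 w, expression R a w & size w = n >])
  is left ex_expr then ex_minn ex_expr else 0.

Definition geodesic R a w : Prop := expression R a w /\ size w = lg R a.

Lemma geodesicP R a w : geodesic R a w <->
  expression R a w /\ forall w', expression R a w' -> (size w <= size w')%N.
Proof.
rewrite /geodesic /lg; case: pselect => [ex_expr|no_expr]; last first.
  split=> -[Ew _]; case: no_expr; exists (size w); apply/asboolP; exact: (ex_intro2 _ _ w).
case: ex_minnP => n /asboolP[w0 Ew0 <-] w0_min; split=> -[Ew w_min]; split=> //.
  by move=> w' Ew'; rewrite w_min; apply/w0_min/asboolP; exists w'.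
apply/eqP; rewrite eqn_leq w_min //=.
by apply/w0_min/asboolP; exists w.
Qed.

(* For Q a subset of a generating set R of G: the subgroup of G generated by Q
   is convex in G with respect to R. *)
Definition convex_generated R Q : Prop :=
  forall a w, generated Q a -> geodesic R a w -> forall l, l \in w -> Q l.1.
End Convexity.

Lemma artin_generated (S : finType) (M : coxeterMatrix S) :
  generated (range (artin_gen M)) = setT.
Proof.
apply/seteqP; split=> // a _ H [[H1 HM HV] genH].
have [w ->] := pres_class_surj a; rewrite pres_classE /gword_val.
apply: big_ind => // -[x b] _; rewrite /gletter_val /=.
have Hx : H (artin_gen M x) by apply: genH; exists x.
by case: b => //; apply: HV.
Qed.

(* Main.v *)
(* The subgroup A_T is the image of a length non-increasing retraction of words.
   Reading a word of A letter by letter, we keep track of an element u of the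
   Coxeter group W that is the shortest one in its coset W_T u.  On reading the
   letter sigma_s^e there are two possibilities: either u s u^-1 is a simple
   reflection r in T, and then we output sigma_r^e and stay at u, or u s is again
   shortest in its coset, and then we output nothing and move to u s.  The word
   that is output represents an element of A which depends only on the element
   represented by the input.  A word on Sigma_T is output unchanged, while any
   other word loses a letter (its first letter outside T at the latest), hence is
   not a geodesic if it represents an element of A_T.

   W is only used through its geometric representation: u s u^-1 = r is read as
   u(alpha_s) = alpha_r, and u is shortest in W_T u when u^-1 maps the simple
   roots of T to positive roots.  For the braid relation between s and t, started
   at u, the reflections that are met correspond to the positive roots of the
   plane of alpha_s and alpha_t, in opposite orders for the two sides.  If two of
   them are mapped by u to simple roots of T, then u maps alpha_s and alpha_t
   themselves to simple roots of T and the output is a braid relation; otherwise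
   both sides output the same word with at most one letter. *)
From HB Require Import structures.
Require Import Defs.
From Stdlib Require Import Reals.
From mathcomp Require Import all_boot all_order all_algebra.
From mathcomp Require Import boolp classical_sets.
From mathcomp Require Import Rstruct zify ring lra.

Set Implicit Arguments.
Unset Strict Implicit.
Unset Printing Implicit Defensive.

Import Order.TTheory GRing.Theory Num.Theory.

Local Open Scope ring_scope.

(** * Chebyshev polynomials of the second kind, the coordinates of roots in rank two *)

Section Chebyshev.
Context (R : realFieldType).
Implicit Types (h : R) (o : option nat).

(* The value [cheb (2 * cos x) k] is [sin (k * x) / sin x]; [cheb2] computes two
   consecutive values. *)
Fixpoint cheb2 h k : R * R :=
  if k is k'.+1 then let: (a, b) := cheb2 h k' in (b, h * b - a) else (0, 1).

Definition cheb h k : R := (cheb2 h k).1.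

Lemma cheb0 h : cheb h 0 = 0. Proof. by []. Qed.
Lemma cheb1 h : cheb h 1 = 1. Proof. by []. Qed.
Lemma chebSS h k : cheb h k.+2 = h * cheb h k.+1 - cheb h k.
Proof. by rewrite /cheb /=; case: (cheb2 h k). Qed.

Lemma cheb_two k : cheb 2 k = k%:R.
Proof.
suff: cheb 2 k = k%:R /\ cheb 2 k.+1 = k.+1%:R by case.
elim: k => // k [IH1 IH2]; split=> //.
by rewrite chebSS IH1 IH2 -[k.+2%:R]natr1 -[k.+1%:R]natr1; ring.
Qed.

(* All that is used of [h = 2 * cos (pi / m)], where [o = Some m], and of [h = 2]
   for an infinite label. *)
Definition dihedral o h : Prop :=
  if o is Some m then
    [/\ forall k, (0 < k < m)%N -> 0 < cheb h k, cheb h m = 0,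
        cheb h m.-1 = 1 & h < 2]
  else forall k, (0 < k)%N -> 0 < cheb h k.

(** The label is the least positive index at which [cheb h] vanishes, or infinity if there is none,
    so it can be read off from [h]. *)
Lemma dihedral_inj o o' h : (forall m, o = Some m -> (2 <= m)%N) ->
  (forall m, o' = Some m -> (2 <= m)%N) ->
  dihedral o h -> dihedral o' h -> o = o'.
Proof.
have lt_false m m' : (2 <= m)%N -> dihedral (Some m) h -> 
   dihedral (Some m') h -> ~~ (m < m')%N.
  move=> m2 [_ hm _ _] [H _ _ _]; apply/negP=> lt.
  by have := H m; rewrite lt hm ltxx (ltn_trans _ m2) // => /(_ isT).
have none m : (2 <= m)%N -> dihedral (Some m) h -> dihedral None h -> False.
  by move=> m2 [_ hm _ _] /(_ m (ltnW m2)); rewrite hm ltxx.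
case: o o' => [m|] [m'|] o2 o2' // D D'; last 2 first.
- by case: (none m) => //; apply: o2.
- by case: (none m') => //; apply: o2'.
have N1 := lt_false _ _ (o2 _ erefl) D D'.
have N2 := lt_false _ _ (o2' _ erefl) D' D.
by congr Some; case: ltngtP N1 N2.
Qed.

(** The recurrence reads the same backwards, and the values at [m] and [m.-1] are those at 0 and
    1. *)
Lemma cheb_sym h m j : dihedral (Some m) h -> (j <= m)%N ->
  cheb h (m - j) = cheb h j.
Proof.
case=> _ hm hm1 _; case: m hm hm1 => [|m] hm hm1; first by case: j.
suff H i : (i <= m)%N -> cheb h (m.+1 - i) = cheb h i /\
    cheb h (m.+1 - i.+1) = cheb h i.+1.
  by case: j => [|j] jm; [case: (H 0%N) | case: (H j)].
elim: i => [|i IH] im; first by rewrite subn0 subSS subn0 /= hm hm1.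
have [IH1 IH2] := IH (ltnW im); split=> //.
rewrite chebSS -IH1 -IH2.
have -> : (m.+1 - i = (m.+1 - i.+2).+2)%N by lia.
have -> : (m.+1 - i.+1 = (m.+1 - i.+2).+1)%N by lia.
rewrite chebSS; ring.
Qed.

Lemma dihedral_ge0 m h k : dihedral (Some m) h -> (k <= m)%N -> 0 <= cheb h k.
Proof.
case=> H hm _ _; rewrite leq_eqVlt => /orP[/eqP->|km]; first by rewrite hm.
by case: k km => // k km; apply/ltW/H.
Qed.
End Chebyshev.

(** * Real solutions of the dihedral conditions *)

Section CosineValues.

Lemma cheb_cos (x : R) k :
  cheb (2 * cos x) k * sin x = sin (k%:R * x)%R.
Proof.
suff: cheb (2 * cos x) k * sin x = sin (k%:R * x)%R /\
  cheb (2 * cos x) k.+1 * sin x = sin (k.+1%:R * x)%R by case.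
elim: k => [|k [IH1 IH2]].
  by rewrite cheb0 cheb1 mulr0n !mul0r !mul1r (sin_0 : sin 0 = 0).
split=> //; rewrite chebSS mulrBl -mulrA IH2 IH1.
set y := k.+1%:R * x.
have -> : k%:R * x = y - x by rewrite /y -natr1; ring.
have -> : k.+2%:R * x = y + x by rewrite /y -natr1; ring.
have /= E1 := sin_plus y x; have /= E2 := sin_minus y x.
rewrite !RealsE in E1 E2.
rewrite E1 E2; ring.
Qed.

Lemma dihedral_exists (o : option nat) :
  (forall m, o = Some m -> (2 <= m)%N) -> exists h : R, dihedral o h.
Proof.
case: o => [m /(_ _ erefl) m2|_]; last first.
  by exists 2 => k; rewrite cheb_two ltr0n.
have pi0 : 0 < PI by apply/RltP; exact: PI_RGT_0.
have m0 : 0 < m%:R :> R by rewrite ltr0n ltnW.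
pose x := PI / m%:R.
have mx : m%:R * x = PI by rewrite /x mulrC divfK ?gt_eqF.
have sin_pos k : (0 < k < m)%N -> 0 < sin (k%:R * x)%R.
  move=> /andP[k0 km]; apply/RltP/sin_gt_0; apply/RltP.
    by rewrite mulr_gt0 ?ltr0n // divr_gt0.
  by rewrite -mx ltr_pM2r ?ltr_nat // divr_gt0.
have sx : 0 < sin x by have := sin_pos 1%N; rewrite mul1r; apply; rewrite m2.
exists (2 * cos x); split.
- move=> k /sin_pos; rewrite -cheb_cos => H.
  by rewrite -(pmulr_lgt0 _ sx).
- apply: (mulIf (lt0r_neq0 sx)); rewrite cheb_cos mx mul0r; exact: sin_PI.
- apply: (mulIf (lt0r_neq0 sx)); rewrite cheb_cos mul1r.
  have -> : m.-1%:R * x = PI - x.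
    by rewrite -mx -{2}(prednK (ltnW m2)) -natr1; ring.
  have := sin_PI_x x; by rewrite !RealsE.
- have := sin2_cos2 x; rewrite /Rsqr !RealsE /= => E.
  nra.
Qed.
End CosineValues.

(** * The geometric representation *)

Section GeometricRepresentation.
Context (R : realFieldType) (S : finType) (M : coxeterMatrix S).
Context (h : option nat -> R).
Hypothesis dihedral_h : forall s t, s != t -> dihedral (M s t) (h (M s t)).

Let V := {ffun S -> R^o}.
Implicit Types (x y : V) (s t r : S) (u v w : seq S).

(** The form of Tits scaled by two: simple roots have norm 2, so [copair] is the pairing with the
    coroot. *)
Definition cartan s t : R := if s == t then 2 else - h (M s t).

Lemma cartan_diag s : cartan s s = 2.
Proof. by rewrite /cartan eqxx. Qed.

Lemma cartan_sym s t : cartan s t = cartan t s.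
Proof. by rewrite /cartan eq_sym coxeter_sym. Qed.

Definition sroot s : V := [ffun t => (t == s)%:R].

Definition copair s (x : V) : R := \sum_t cartan s t * x t.

Lemma copair_is_linear s : linear_for *%R (copair s).
Proof.
move=> a x y; rewrite /copair mulr_sumr -big_split /=; apply: eq_bigr => t _.
by rewrite !ffunE /GRing.scale /=; ring.
Qed.

HB.instance Definition _ s :=
  GRing.isLinear.Build R V R *%R (copair s) (copair_is_linear s).

Lemma sum_sroot s (f : S -> R) : \sum_t f t * sroot s t = f s.
Proof.
rewrite (bigD1 s) //= ffunE eqxx mulr1 big1 ?addr0 // => t /negbTE ts.
by rewrite ffunE ts mulr0.
Qed.

Lemma copair_sroot s t : copair s (sroot t) = cartan s t.
Proof. exact: sum_sroot. Qed.

Definition form x y : R := \sum_s x s * copair s y.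

Lemma form_sym x y : form x y = form y x.
Proof.
rewrite /form; under eq_bigr => s _ do rewrite mulr_sumr.
under [RHS]eq_bigr => s _ do rewrite mulr_sumr.
rewrite exchange_big; apply: eq_bigr => t _; apply: eq_bigr => s _ /=.
by rewrite cartan_sym; ring.
Qed.

Lemma form_is_linear x : linear_for *%R (form x).
Proof.
move=> a y z; rewrite /form mulr_sumr -big_split /=; apply: eq_bigr => t _.
by rewrite linearP /=; ring.
Qed.

HB.instance Definition _ x :=
  GRing.isLinear.Build R V R *%R (form x) (form_is_linear x).

Lemma form_srootl s x : form (sroot s) x = copair s x.
Proof.
rewrite /form -[RHS](sum_sroot s (fun t => copair t x)).
by apply: eq_bigr => t _; rewrite mulrC.
Qed.

Lemma form_sroot s t : form (sroot s) (sroot t) = cartan s t.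
Proof. by rewrite form_srootl copair_sroot. Qed.

Definition srefl s x : V := x - copair s x *: sroot s.

Lemma srefl_is_linear s : linear (srefl s).
Proof.
move=> a x y; rewrite /srefl linearP /= scalerDl opprD scalerBr scalerA.
by rewrite addrACA.
Qed.

HB.instance Definition _ s :=
  GRing.isLinear.Build R V V *:%R (srefl s) (srefl_is_linear s).

Lemma srefl_sroot s : srefl s (sroot s) = - sroot s.
Proof.
rewrite /srefl copair_sroot cartan_diag scaler_nat mulr2n opprD addrA subrr.
by rewrite add0r.
Qed.

Lemma sreflK s : involutive (srefl s).
Proof.
move=> x; rewrite {2}/srefl linearB linearZ /= srefl_sroot /srefl scalerN opprK.
by rewrite subrK.
Qed.

Lemma form_srefl s x y : form (srefl s x) (srefl s y) = form x y.
Proof.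
have E z : form z (sroot s) = copair s z by rewrite form_sym form_srootl.
rewrite {2}/srefl linearB linearZ /= E [form (srefl s x) y]form_sym /srefl.
rewrite !linearB !linearZ /= copair_sroot cartan_diag E form_sym.
by ring.
Qed.

(** The last letter acts first: [rcons u s] is the product of [u] and [s], and [rev u] is the
    inverse of [u]. *)
Definition act u x : V := foldr srefl x u.

Lemma act_is_linear u : linear (act u).
Proof. by elim: u => [|s u IHu] a x y //=; rewrite IHu linearP. Qed.

HB.instance Definition _ u :=
  GRing.isLinear.Build R V V *:%R (act u) (act_is_linear u).

Lemma act_cat u v x : act (u ++ v) x = act u (act v x).
Proof. exact: foldr_cat. Qed.

Lemma act_rcons u s x : act (rcons u s) x = act u (srefl s x).
Proof. exact: foldr_rcons. Qed.

Lemma act_rcons_sroot u s : act (rcons u s) (sroot s) = - act u (sroot s).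
Proof. by rewrite act_rcons srefl_sroot linearN. Qed.

Lemma act_rev u : cancel (act u) (act (rev u)).
Proof. by elim: u => //= s u IHu x; rewrite rev_cons act_rcons sreflK IHu. Qed.

Lemma act_revK u : cancel (act (rev u)) (act u).
Proof. by move=> x; rewrite -{1}[u]revK act_rev. Qed.

Lemma form_act u x y : form (act u x) (act u y) = form x y.
Proof. by elim: u => //= s u IHu; rewrite form_srefl. Qed.

(** A reflection is determined by its root because [act u] preserves the form. *)
Lemma act_sroot_srefl u s r x : act u (sroot s) = sroot r ->
  act u (srefl s x) = srefl r (act u x).
Proof.
move=> us; rewrite /srefl linearB linearZ /= us; congr (_ - _ *: _).
by rewrite -[RHS]form_srootl -us form_act form_srootl.
Qed.

Definition nonneg x := [forall s, 0 <= x s].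

Lemma nonnegP x : reflect (forall s, 0 <= x s) (nonneg x).
Proof. exact: forallP. Qed.

Lemma sroot_nonneg s : nonneg (sroot s).
Proof. by apply/nonnegP => t; rewrite ffunE ler0n. Qed.

Lemma plane_nonneg a b x y : 0 <= a -> 0 <= b -> nonneg x -> nonneg y ->
  nonneg (a *: x + b *: y).
Proof.
move=> a0 b0 /nonnegP x0 /nonnegP y0; apply/nonnegP => s.
by rewrite !ffunE addr_ge0 // mulr_ge0.
Qed.

Lemma sroot_inj : injective sroot.
Proof.
move=> s t /ffunP/(_ s); rewrite !ffunE eqxx; case: eqVneq => // _ /eqP.
by rewrite (oner_eq0 R).
Qed.

Lemma act_sroot_nonneg_excl u s :
  nonneg (act u (sroot s)) -> nonneg (- act u (sroot s)) -> False.
Proof.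
move=> /nonnegP P /nonnegP N; have E : act u (sroot s) = 0.
  apply/ffunP => t; have := P t; have := N t; rewrite !ffunE oppr_ge0 => ? ?.
  by apply/eqP; rewrite eq_le; apply/andP.
have := form_act u (sroot s) (sroot s); rewrite E linear0 form_sroot.
by rewrite cartan_diag => /esym/eqP; rewrite pnatr_eq0.
Qed.

(** * Rank two: alternating words and the braid relation *)

Fixpoint alt s t k : seq S := if k is k'.+1 then s :: alt t s k' else [::].

Lemma size_alt s t k : size (alt s t k) = k.
Proof. by elim: k s t => //= k IH s t; rewrite IH. Qed.

Lemma altS s t k : alt s t k.+1 = rcons (alt s t k) (if odd k then t else s).
Proof. by elim: k s t => //= k IH s t; rewrite [alt s t _]/= IH; case: (odd k). Qed.

(** Peeling off the first letter exchanges [s] and [t]; reflecting in [s] then turns the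
    coefficients into the recurrence [chebSS]. *)
Lemma act_alt_sroot s t k : s != t ->
  act (alt s t k) (sroot (if odd k then t else s)) =
    cheb (h (M s t)) k.+1 *: sroot s + cheb (h (M s t)) k *: sroot t.
Proof.
elim: k s t => [|k IH] s t st.
  by rewrite cheb0 cheb1 scale1r scale0r addr0.
rewrite /= -if_neg negbK; have := IH t s; rewrite eq_sym => /(_ st) ->.
rewrite [M t s]coxeter_sym chebSS linearD !linearZ /= srefl_sroot.
rewrite {1}/srefl copair_sroot /cartan (negbTE st).
by apply/ffunP => r; rewrite !ffunE /GRing.scale /=; ring.
Qed.

(** The values of [cheb] at [m.-1], [m] and [m.+1] are 1, 0 and -1. *)
Lemma braid_basis s t m : s != t -> M s t = Some m ->
  act (alt s t m) (sroot (if odd m then t else s)) = - sroot s /\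
  act (alt s t m) (sroot (if odd m then s else t)) = - sroot t.
Proof.
move=> st Em; have := dihedral_h st; rewrite Em => -[_ hm hm1 _].
have m2 := coxeter_ge2 st Em; case: m m2 Em hm hm1 => [//|m] m2 Em hm hm1.
split.
  rewrite act_alt_sroot // Em chebSS hm hm1.
  by apply/ffunP => r; rewrite !ffunE /GRing.scale /=; ring.
rewrite altS act_rcons [odd _]/= if_neg srefl_sroot linearN /=.
rewrite act_alt_sroot // Em hm hm1 scale0r scale1r add0r //.
Qed.

Lemma act_fixed u x : (forall s, s \in u -> copair s x = 0) -> act u x = x.
Proof.
elim: u => //= s u IHu H; rewrite IHu => [|t tu]; last by apply: H; rewrite inE tu orbT.
by rewrite /srefl H ?inE ?eqxx // scale0r subr0.
Qed.

Lemma mem_alt s t k r : r \in alt s t k -> (r == s) || (r == t).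
Proof.
elim: k s t => //= k IH s t; rewrite inE => /orP[->//|/IH].
by rewrite orbC.
Qed.

(** Both sides agree on the plane of the two simple roots by [braid_basis] and fix the vectors
    orthogonal to it. For a finite label [h] is less than 2, so the form is nondegenerate on the
    plane and these vectors span everything. *)
Lemma act_braid s t m : s != t -> M s t = Some m ->
  act (alt s t m) =1 act (alt t s m).
Proof.
move=> st Em x; have := dihedral_h st; rewrite Em => -[hp hm _ h2].
have m2 := coxeter_ge2 st Em.
have [E1 E2] := braid_basis st Em.
have [E3 E4] : act (alt t s m) (sroot (if odd m then s else t)) = - sroot t /\
  act (alt t s m) (sroot (if odd m then t else s)) = - sroot s.
  by apply: braid_basis; rewrite 1?eq_sym // coxeter_sym.
have [Es Et] : act (alt s t m) (sroot s) = act (alt t s m) (sroot s) /\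
               act (alt s t m) (sroot t) = act (alt t s m) (sroot t).
  by move: E1 E2 E3 E4; case: (odd m) => -> -> -> ->.
have h0 : 0 <= h (Some m).
  have := dihedral_h st; rewrite Em => /dihedral_ge0 /(_ m2).
  by rewrite chebSS cheb1 cheb0 subr0 mulr1.
set c := h (Some m) in h0 h2 hp hm.
(* This is the determinant of the Gram matrix of the two roots; Cramer's rule gives [p] and [q],
   which make [y] orthogonal to both. *)
have d0 : 4 - c ^+ 2 != 0 by apply: lt0r_neq0; nra.
pose p := (2 * copair s x + c * copair t x) / (4 - c ^+ 2).
pose q := (c * copair s x + 2 * copair t x) / (4 - c ^+ 2).
pose y := x - (p *: sroot s + q *: sroot t).
have Ex : x = y + (p *: sroot s + q *: sroot t) by rewrite /y subrK.
have ys : copair s y = 0.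
  rewrite /y linearB linearD !linearZ /= !copair_sroot cartan_diag /cartan.
  by rewrite (negbTE st) Em -/c /p /q; field.
have yt : copair t y = 0.
  rewrite /y linearB linearD !linearZ /= !copair_sroot cartan_diag cartan_sym /cartan.
  by rewrite (negbTE st) Em -/c /p /q; field.
have fixy a b : (a = s /\ b = t) \/ (a = t /\ b = s) -> act (alt a b m) y = y.
  by move=> ab; apply: act_fixed => r /mem_alt; case: ab => -[-> ->] /orP[] /eqP->.
clearbody y; rewrite Ex !linearD !linearZ /= Es Et !fixy //; by [left | right].
Qed.


(** * Sign of roots *)

Definition reduced u := forall v, act v =1 act u -> (size u <= size v)%N.

Lemma reduced_exists u : exists2 v, act v =1 act u & reduced v.
Proof.
have [n] := ubnP (size u); elim: n u => // n IHn u; rewrite ltnS => un.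
have [ured|/existsNP[v /not_implyP[vu /negP]]] := pselect (reduced u).
  by exists u.
rewrite -ltnNge => /leq_trans/(_ un)/IHn[w wv wred].
by exists w => // x; rewrite wv vu.
Qed.

Lemma take_alt s t m k : (m <= k)%N -> take m (alt s t k) = alt s t m.
Proof. by elim: m k s t => [|m IH] [|k] s t //= mk; rewrite IH. Qed.

(** A word that does not alternate has two equal neighbours, which cancel. The loss of two letters
    matters in [dihedral_nonneg], where [rcons u s] is shortened but compared with [u]. *)
Lemma alt_or_shorter s t z : {subset z <= [:: s; t]} ->
  [\/ z = alt s t (size z), z = alt t s (size z) |
      exists2 z', act z' =1 act z & ((size z').+1 < size z)%N].
Proof.
have cancel p q k r z1 : z1 = alt p q k -> r = p -> (0 < k)%N ->
    exists2 z', act z' =1 act (r :: z1) & ((size z').+1 < (size z1).+1)%N.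
  move=> -> -> {r z1}; case: k => // k _; exists (alt q p k) => /=.
    by move=> x /=; rewrite sreflK.
  by [].
elim: z => [|r z IH] zst; first by constructor 1.
have {}IH := IH (fun a az => zst a (mem_behead (s := r :: z) az)).
have := zst r (mem_head _ _); rewrite !inE.
case: IH => [E|E|[z' z'z lt]]; last first.
- by move=> _; constructor 3; exists (r :: z') => // x /=; rewrite z'z.
- case/orP=> /eqP rE; first by constructor 1; rewrite /= -E rE.
  case: (posnP (size z)) => [/eqP/nilP z0|z_gt0].
    by constructor 2; rewrite z0 /= rE.
  by constructor 3; apply: cancel E rE z_gt0.
- case/orP=> /eqP rE; last by constructor 2; rewrite /= -E rE.
  case: (posnP (size z)) => [/eqP/nilP z0|z_gt0].
    by constructor 1; rewrite z0 /= rE.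
  by constructor 3; apply: cancel E rE z_gt0.
Qed.

(** The hypothesis forces [rcons u s] to alternate and, for a finite label, [u] to be shorter than
    the label. In that range the coefficients from [act_alt_sroot] are nonnegative. *)
Lemma dihedral_nonneg s t u : s != t -> {subset u <= [:: s; t]} ->
  (forall v, act v =1 act (rcons u s) -> (size u <= size v)%N) ->
  exists a b, [/\ 0 <= a, 0 <= b & act u (sroot s) = a *: sroot s + b *: sroot t].
Proof.
move=> st ust long.
have alternating_case p q : p != q -> rcons u s = alt p q (size u).+1 ->
    exists a b, [/\ 0 <= a, 0 <= b &
                 act u (sroot s) = a *: sroot p + b *: sroot q].
  move=> pq E; have := E; rewrite altS => /rcons_inj[ualt Es].
  exists (cheb (h (M p q)) (size u).+1), (cheb (h (M p q)) (size u)).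
  rewrite {3}ualt Es act_alt_sroot //; have D := dihedral_h pq.
  case Em: (M p q) D => [m|] D; last first.
    split=> //; first exact/ltW/D.
    by case: (size u) => [|k]; [rewrite cheb0 | exact/ltW/D].
  have [um|mu] := ltnP (size u) m.
    by split=> //; apply: (dihedral_ge0 D) => //; exact: ltnW.
  have m2 := coxeter_ge2 pq Em.
  (* In a longer word, the [m] letters after the initial [p] are replaced by the other side of the
     braid relation, whose first letter cancels this [p]. *)
  pose w := drop m (alt q p (size u)).
  suff : (size u <= size (alt q p m.-1 ++ w))%N.
    by rewrite size_cat size_drop !size_alt; lia.
  apply: long => x; rewrite E /=.
  rewrite -(cat_take_drop m (alt q p (size u))) -/w take_alt // !act_cat.
  have Ep : alt p q m = p :: alt q p m.-1 by rewrite -{1}(prednK (ltnW m2)).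
  by rewrite -(act_braid pq Em) Ep /= sreflK.
have zst : {subset rcons u s <= [:: s; t]}.
  by move=> r; rewrite mem_rcons inE => /predU1P[->|/ust//]; exact: mem_head.
case: (alt_or_shorter zst); rewrite size_rcons.
- exact: alternating_case.
- move=> /alternating_case; rewrite eq_sym => /(_ st)[a [b [a0 b0 ->]]].
  by exists b, a; rewrite addrC.
- by case=> v /long uv; rewrite ltnS ltnNge uv.
Qed.

(* Writing [u = v x] with [x] in the dihedral subgroup of [s] and the last letter
   of [u], and [v] as short as possible, reduces the claim to the rank 2 case for
   [x] and to the induction hypothesis for [v]. *)
Lemma act_sroot_nonneg_reduced u s : reduced u ->
  (forall v, act v =1 act (rcons u s) -> (size u <= size v)%N) ->
  nonneg (act u (sroot s)).
Proof.
have [n] := ubnP (size u); elim: n u s => // n IHn u s; rewrite ltnS => un ured long.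
case/lastP: u => [|u t] in un ured long *; first exact: sroot_nonneg.
have [st|st] := eqVneq s t.
  suff /long : act u =1 act (rcons (rcons u t) s) by rewrite size_rcons ltnn.
  by move=> x; rewrite st !act_rcons sreflK.
pose P k := `[< exists v (x : seq S), [/\ size v = k, {subset x <= [:: s; t]},
  act (v ++ x) =1 act (rcons u t) & (size v + size x = size (rcons u t))%N] >].
have Pu : exists k, P k.
  exists (size u); apply/asboolP; exists u, [:: t]; rewrite cats1 size_rcons addn1.
  by split=> // r; rewrite !inE orbC => ->.
case: (ex_minnP Pu) => k /asboolP[v [x [vk xst vx sz]]] kmin.
have lt_vu : (size v < size (rcons u t))%N.
  rewrite vk size_rcons ltnS; apply: kmin; apply/asboolP; exists u, [:: t].
  by rewrite cats1 size_rcons addn1; split=> // r; rewrite !inE orbC => ->.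
have vnonneg r : r \in [:: s; t] -> nonneg (act v (sroot r)).
  move=> rst; apply: IHn => [|w wv|w wvr]; first exact: leq_trans lt_vu un.
    rewrite -(leq_add2r (size x)) sz -size_cat; apply: ured => z.
    by rewrite -vx !act_cat wv.
  (* A shorter word for [rcons v r] would allow moving [r] over to [x], against the minimality of
     [v]. *)
  rewrite leqNgt; apply/negP => wv.
  have wrx : act (w ++ r :: x) =1 act (rcons u t).
    by move=> z; rewrite -vx !act_cat wvr act_rcons /= sreflK.
  have := ured _ wrx; rewrite -sz size_cat /= => le_sz.
  suff /kmin : P (size w) by rewrite leqNgt -vk wv.
  apply/asboolP; exists w, (r :: x); split=> //.
    by move=> r'; rewrite in_cons => /predU1P[->|/xst].
  by move: wv le_sz; rewrite -sz /=; lia.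
have [|a [b [a0 b0 xs]]] := dihedral_nonneg st xst.
  move=> y yx; rewrite -(leq_add2l (size v)) sz -size_cat; apply: long => z.
  by rewrite act_rcons -vx !act_cat yx act_rcons.
rewrite -vx act_cat xs linearD !linearZ /=.
by apply: plane_nonneg => //; apply: vnonneg; rewrite !inE eqxx ?orbT.
Qed.

(** Take [u] shortest. If a word shorter than [u] represents [rcons u s], then a shortest such word
    [w] satisfies the previous lemma, and the root of [u] is the opposite of that of [w]. *)
Lemma act_sroot_sign u s :
  nonneg (act u (sroot s)) \/ nonneg (- act u (sroot s)).
Proof.
have [u' uu' u'red] := reduced_exists u; rewrite -uu'.
have [long|] := pselect (forall v, act v =1 act (rcons u' s) -> (size u' <= size v)%N).
  by left; apply: act_sroot_nonneg_reduced.
move=> /existsNP[v /not_implyP[vu /negP]]; rewrite -ltnNge => lt_vu; right.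
have [w wv wred] := reduced_exists v.
have wu : act (rcons w s) =1 act u'.
  by move=> x; rewrite act_rcons wv vu act_rcons sreflK.
rewrite -wu act_rcons_sroot opprK; apply: act_sroot_nonneg_reduced => // y yw.
have /u'red : act y =1 act u' by move=> x; rewrite yw wu.
apply: leq_trans; apply: leq_trans (ltnW lt_vu); exact: wred.
Qed.

Lemma sroot_scale_eq1 u s r a : 0 <= a -> sroot r = a *: act u (sroot s) -> a = 1.
Proof.
move=> a0 E; have := form_sroot r r; rewrite {1 2}E linearZ /= form_sym linearZ /=.
by rewrite form_act form_sroot !cartan_diag => F; nra.
Qed.

Lemma plane_ge0 s t a b : s != t -> nonneg (a *: sroot s + b *: sroot t) ->
  0 <= a /\ 0 <= b.
Proof.
move=> st /nonnegP N; have := N s; have := N t; rewrite !ffunE !eqxx.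
rewrite [t == s]eq_sym (negbTE st) /GRing.scale /= !mulr0 !mulr1 addr0 add0r.
by split.
Qed.

(** In the coordinates [r] and [r'], the images of the two simple roots are the rows of the inverse
    of the matrix with rows [(a, b)] and [(c, d)]. Each row has one sign, which makes this
    nonnegative matrix monomial; comparing norms makes it a permutation. *)
Lemma plane_simple u s t r r' a b c d : s != t -> r != r' ->
  0 <= a -> 0 <= b -> 0 <= c -> 0 <= d ->
  act (rev u) (sroot r) = a *: sroot s + b *: sroot t ->
  act (rev u) (sroot r') = c *: sroot s + d *: sroot t ->
  act u (sroot s) = sroot r /\ act u (sroot t) = sroot r' \/
  act u (sroot s) = sroot r' /\ act u (sroot t) = sroot r.
Proof.
move=> st rr' a0 b0 c0 d0 /(congr1 (act u)) E /(congr1 (act u)) E'.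
rewrite act_revK linearD !linearZ /= in E; rewrite act_revK linearD !linearZ /= in E'.
have sign q : 0 <= act u (sroot q) r * act u (sroot q) r'.
  case: (act_sroot_sign u q) => /nonnegP N; have := N r; have := N r'.
    by move=> ? ?; rewrite mulr_ge0.
  by rewrite !ffunE => ? ?; rewrite -mulrNN mulr_ge0.
have coord (z x y : V) p q i : z = p *: x + q *: y -> z i = p * x i + q * y i.
  by move=> ->; rewrite !ffunE.
have := sign t; have := sign s.
have := coord _ _ _ _ _ r E; have := coord _ _ _ _ _ r' E.
have := coord _ _ _ _ _ r E'; have := coord _ _ _ _ _ r' E'.
rewrite !ffunE !eqxx [r' == r]eq_sym (negbTE rr') /=.
set X := act u (sroot s) r; set X' := act u (sroot s) r'.
set Y := act u (sroot t) r; set Y' := act u (sroot t) r'.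
rewrite !mulr1n !mulr0n => e1 e2 e3 e4 XX YY.
pose D := a * d - b * c.
have DX : D * X = d.
  have -> : D * X = d * (a * X + b * Y) - b * (c * X + d * Y) by rewrite /D; ring.
  by rewrite -e4 -e2; ring.
have DX' : D * X' = - b.
  have -> : D * X' = d * (a * X' + b * Y') - b * (c * X' + d * Y').
    by rewrite /D; ring.
  by rewrite -e3 -e1; ring.
have DY : D * Y = - c.
  have -> : D * Y = a * (c * X + d * Y) - c * (a * X + b * Y) by rewrite /D; ring.
  by rewrite -e4 -e2; ring.
have DY' : D * Y' = a.
  have -> : D * Y' = a * (c * X' + d * Y') - c * (a * X' + b * Y').
    by rewrite /D; ring.
  by rewrite -e3 -e1; ring.
have bd : b * d <= 0.
  have : 0 <= (D * X) * (D * X') by rewrite mulrACA mulr_ge0 // -expr2 sqr_ge0.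
  by rewrite DX DX' mulrN mulrC oppr_ge0.
have ac : a * c <= 0.
  have : 0 <= (D * Y) * (D * Y') by rewrite mulrACA mulr_ge0 // -expr2 sqr_ge0.
  by rewrite DY DY' mulNr mulrC oppr_ge0.
have {bd} : b * d == 0 by rewrite eq_le bd mulr_ge0.
have {ac} : a * c == 0 by rewrite eq_le ac mulr_ge0.
have zero (x y : V) : 0 *: x + y = y by rewrite scale0r add0r.
rewrite !mulf_eq0 => ac /orP[] /eqP z0.
  have a_neq0 : a != 0.
    by apply/eqP => a00; move: e4; rewrite a00 z0 !mul0r addr0 => /eqP; rewrite oner_eq0.
  move: ac; rewrite (negbTE a_neq0) => /eqP c00; rewrite c00 in E'; rewrite z0 in E.
  rewrite addrC zero in E; rewrite zero in E'.
  have Ea := sroot_scale_eq1 a0 E; have Ed := sroot_scale_eq1 d0 E'.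
  by left; rewrite E E' Ea Ed !scale1r.
have c_neq0 : c != 0.
  by apply/eqP => c00; move: e1; rewrite c00 z0 !mul0r addr0 => /eqP; rewrite oner_eq0.
move: ac; rewrite orbC (negbTE c_neq0) => /eqP a00; rewrite a00 in E; rewrite z0 in E'.
rewrite addrC zero in E'; rewrite zero in E.
have Eb := sroot_scale_eq1 b0 E; have Ec := sroot_scale_eq1 c0 E'.
by right; rewrite E E' Eb Ec !scale1r.
Qed.


(** * The retraction onto words on T *)

Section Retraction.
Context (T : {set S}).

(* The word [u] represents the shortest element of its coset modulo [T]. *)
Definition minimal u := forall r, r \in T -> nonneg (act (rev u) (sroot r)).

(** For minimal [u], [Some r] marks a loop at the coset of [u] in the Schreier graph of the cosets
    of W_T. *)
Definition loop u s : option S :=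
  [pick r | (r \in T) && (act u (sroot s) == sroot r)].

Lemma loop_someP u s r :
  loop u s = Some r <-> r \in T /\ act u (sroot s) = sroot r.
Proof.
rewrite /loop; case: pickP => [r' /andP[r'T /eqP Er']|no].
  by split=> [[<-]//|[_]]; rewrite Er' => /sroot_inj->.
by split=> // -[rT /eqP Er]; have := no r; rewrite rT Er.
Qed.

Lemma eq_loop u v s : act u =1 act v -> loop u s = loop v s.
Proof. by move=> uv; rewrite /loop; apply: eq_pick => r /=; rewrite uv. Qed.

Definition step u s := if loop u s is Some _ then u else rcons u s.

Fixpoint endpoint u (w : gword S) : seq S :=
  if w is (s, _) :: w' then endpoint (step u s) w' else u.

Fixpoint retract u (w : gword S) : gword S :=
  if w is (s, b) :: w' then
    oapp (fun r => [:: (r, b)]) [::] (loop u s) ++ retract (step u s) w'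
  else [::].

Lemma endpoint_cat u (w w' : gword S) : endpoint u (w ++ w') = endpoint (endpoint u w) w'.
Proof. by elim: w u => // -[s b] w IH u /=; rewrite IH. Qed.

Lemma retract_cat u (w w' : gword S) :
  retract u (w ++ w') = retract u w ++ retract (endpoint u w) w'.
Proof. by elim: w u => // -[s b] w IH u /=; rewrite IH catA. Qed.

Lemma eq_step u v s : act u =1 act v -> act (step u s) =1 act (step v s).
Proof.
move=> uv x; rewrite /step (eq_loop _ uv); case: (loop v s) => [_|] //.
by rewrite !act_rcons uv.
Qed.

Lemma eq_endpoint u v (w : gword S) : act u =1 act v ->
  act (endpoint u w) =1 act (endpoint v w).
Proof. by elim: w u v => // -[s b] w IH u v uv; apply/IH/eq_step. Qed.

Lemma eq_retract u v (w : gword S) : act u =1 act v -> retract u w = retract v w.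
Proof.
elim: w u v => // -[s b] w IH u v uv /=.
by rewrite (eq_loop _ uv) (IH _ _ (eq_step s uv)).
Qed.

(** A simple reflection changes a single coordinate, so [s] can only make a positive root negative
    if that root is [sroot s]. If it is the preimage of [sroot r], then [s] is a loop at [u]. *)
Lemma minimal_step u s : minimal u -> minimal (step u s).
Proof.
move=> umin; rewrite /step; case Es: (loop u s) => [//|] r rT.
have [//|N] := act_sroot_sign (rev (rcons u s)) r.
suff : loop u s = Some r by rewrite Es.
apply/loop_someP; split=> //; move: N; rewrite rev_rcons /=.
have P := umin r rT; set x := act (rev u) (sroot r) in P *.
move=> N; have Ex : x = x s *: sroot s.
  apply/ffunP => t; rewrite !ffunE; have [->|ts] := eqVneq t s.
    by rewrite /GRing.scale /= mulr1.
  move/nonnegP: N => /(_ t); rewrite !ffunE (negbTE ts) scaler0 subr0 oppr_ge0.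
  by move/nonnegP: P => /(_ t) p n; rewrite scaler0; apply/eqP; rewrite eq_le n p.
have Er : sroot r = x s *: act u (sroot s).
  by rewrite -[sroot r](act_revK u) -/x {1}Ex linearZ.
have xs1 : x s = 1 by apply: sroot_scale_eq1 Er; move/nonnegP: P.
by rewrite Er xs1 scale1r.
Qed.

Lemma minimal_endpoint u (w : gword S) : minimal u -> minimal (endpoint u w).
Proof. by elim: w u => // -[s b] w IH u umin; apply/IH/minimal_step. Qed.

(** * Reading the two sides of a braid relation *)

Definition positive_word u : gword S := [seq (s, true) | s <- u].

Lemma retract_no_loop u v :
  (forall p s q, v = p ++ s :: q -> loop (u ++ p) s = None) ->
  retract u (positive_word v) = [::] /\ endpoint u (positive_word v) = u ++ v.
Proof.
elim: v u => [|s v IH] u no /=; first by rewrite cats0.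
have us : loop u s = None by rewrite -[u]cats0; apply: (no [::] s v).
rewrite /step us /= -cat_rcons; apply: IH => p t q Ev.
by rewrite cat_rcons; apply: (no (s :: p) t q); rewrite Ev.
Qed.

(* The root whose reflection is met at the [k]-th letter, counted from 0, of the
   alternating word that starts with [s]. *)
Definition plane_root s t k : V :=
  cheb (h (M s t)) k.+1 *: sroot s + cheb (h (M s t)) k *: sroot t.

Lemma plane_root_sym s t m k : s != t -> M s t = Some m -> (k < m)%N ->
  plane_root t s (m.-1 - k) = plane_root s t k.
Proof.
move=> st Em km; have := dihedral_h st; rewrite /plane_root [M t s]coxeter_sym Em => D.
have -> : (m.-1 - k = m - k.+1)%N by lia.
have -> : ((m - k.+1).+1 = m - k)%N by lia.
by rewrite addrC !(cheb_sym D) // ltnW.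
Qed.

Lemma plane_root_nonneg s t m k : s != t -> M s t = Some m -> (k < m)%N ->
  nonneg (plane_root s t k).
Proof.
move=> st Em km; have := dihedral_h st; rewrite Em => D.
by rewrite /plane_root Em plane_nonneg ?sroot_nonneg // (dihedral_ge0 D) // ltnW.
Qed.

Lemma alt_split s t m p r q : s != t -> alt s t m = p ++ r :: q ->
  (size p < m)%N /\ act p (sroot r) = plane_root s t (size p).
Proof.
move=> st E; have szm : (size p < m)%N.
  by rewrite -(size_alt s t m) E size_cat /= -[X in (X < _)%N]addn0 ltn_add2l.
split=> //; have := congr1 (take (size p).+1) E; rewrite take_alt // altS.
rewrite -cat_rcons take_cat size_rcons ltnn subnn take0 cats0.
by move=> /rcons_inj[Ep Er]; rewrite -{1}Ep -Er act_alt_sroot.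
Qed.

Lemma alt_nth s t m k : (k < m)%N -> exists p r q,
  alt s t m = p ++ r :: q /\ size p = k.
Proof.
move=> km; exists (alt s t k), (if odd k then t else s), (drop k.+1 (alt s t m)).
by rewrite -cat_rcons -altS -{1}(take_alt s t km) cat_take_drop size_alt.
Qed.

(** The case in which every letter of both sides is a loop. *)
Definition plane_standard u s t :=
  exists r r', [/\ r \in T, r' \in T, act u (sroot s) = sroot r &
                   act u (sroot t) = sroot r'].

Lemma plane_standard_sym u s t : plane_standard u s t -> plane_standard u t s.
Proof. by case=> r [r' [*]]; exists r', r. Qed.

(** Minimality of [u] supplies the signs that [plane_simple] requires. *)
Lemma plane_simple_uniq u s t r r' a b c d : s != t -> minimal u ->
  ~ plane_standard u s t -> r \in T -> r' \in T ->
  act (rev u) (sroot r) = a *: sroot s + b *: sroot t ->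
  act (rev u) (sroot r') = c *: sroot s + d *: sroot t -> r = r'.
Proof.
move=> st umin nstd rT r'T E E'; apply/eqP/negPn/negP => rr'; apply: nstd.
have := umin r rT; rewrite E => /(plane_ge0 st)[a0 b0].
have := umin r' r'T; rewrite E' => /(plane_ge0 st)[c0 d0].
case: (plane_simple st rr' a0 b0 c0 d0 E E') => -[us ut].
  by exists r, r'.
by exists r', r.
Qed.

Lemma retract_alt_none u s t m : s != t ->
  (forall k r, (k < m)%N -> r \in T -> act u (plane_root s t k) <> sroot r) ->
  retract u (positive_word (alt s t m)) = [::] /\
  endpoint u (positive_word (alt s t m)) = u ++ alt s t m.
Proof.
move=> st no; apply: retract_no_loop => p x q /(alt_split st)[pm Ep].
case E: (loop _ _) => [r|//]; have /loop_someP[rT] := E.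
by rewrite act_cat Ep => /no; case.
Qed.

(** Skipping the letter that emits [r] amounts to multiplying by the reflection [srefl r] on the
    left; all other letters are appended to the state. *)
Lemma retract_alt_some u s t m k r : s != t -> M s t = Some m -> minimal u ->
  ~ plane_standard u s t -> (k < m)%N -> r \in T ->
  act u (plane_root s t k) = sroot r ->
  retract u (positive_word (alt s t m)) = [:: (r, true)] /\
  forall x, act (endpoint u (positive_word (alt s t m))) x =
            srefl r (act (u ++ alt s t m) x).
Proof.
move=> st Em umin nstd km rT Ek.
(* Before the loop [c] is 0; after it, the multiple of [sroot r] accounts for the reflection by
   which the state differs from the plain product. *)
have uniq_r k' r' c : r' \in T ->
    act u (plane_root s t k') - c *: sroot r = sroot r' -> r' = r.
  move=> r'T Ek'; symmetry; have Er : act (rev u) (sroot r) = plane_root s t k.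
    by rewrite -Ek act_rev.
  apply: (plane_simple_uniq st umin nstd rT r'T Er).
  rewrite -Ek' linearB linearZ /= act_rev Er /plane_root scalerDr !scalerA.
  by rewrite opprD addrACA -!scalerBl.
have exk : exists k, (k < m)%N && (act u (plane_root s t k) == sroot r).
  by exists k; rewrite km Ek eqxx.
have {k km Ek} [k /andP[km /eqP Ek] kmin] := ex_minnP exk.
have [p [x [q [E pk]]]] := alt_nth s t km.
have [_ Ep] := alt_split st E.
have [] := @retract_no_loop u p.
  move=> p1 y p2 Ep12; case Ey: (loop _ _) => [r'|//].
  have E' : alt s t m = p1 ++ y :: (p2 ++ x :: q) by rewrite E Ep12 -catA.
  have [p1m Ep1] := alt_split st E'.
  have /loop_someP[r'T] := Ey; rewrite act_cat Ep1 => Er'.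
  have rr' : r' = r by apply: (uniq_r (size p1) _ 0) => //; rewrite scale0r subr0.
  have := kmin (size p1); rewrite p1m Er' rr' eqxx => /(_ isT).
  by rewrite -pk Ep12 size_cat /= -[X in (_ <= X)%N]addn0 leq_add2l.
move=> retp endp.
have upx : act (u ++ p) (sroot x) = sroot r by rewrite act_cat Ep pk.
have upr z : act (u ++ p) (srefl x z) = srefl r (act (u ++ p) z).
  exact: act_sroot_srefl.
have loopx : loop (u ++ p) x = Some r by apply/loop_someP.
have [] := @retract_no_loop (u ++ p) q.
  move=> q1 y q2 Eq; case Ey: (loop _ _) => [r'|//].
  have E' : alt s t m = (p ++ x :: q1) ++ y :: q2 by rewrite E Eq -catA.
  have [k'm Eq1] := alt_split st E'.
  have /loop_someP[r'T] := Ey.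
  set k' := size _ in k'm Eq1; have Ek' : act u (plane_root s t k') =
      srefl r (act ((u ++ p) ++ q1) (sroot y)).
    by rewrite -Eq1 -!act_cat catA act_cat /= upr -act_cat.
  move=> Er'; have Ek'' := Ek'; rewrite Er' in Ek'.
  have rr' : r' = r.
    apply: (uniq_r k' _ (copair r (act u (plane_root s t k')))) => //.
    by rewrite -[LHS]/(srefl r _) Ek' sreflK.
  (* A second loop would make the plane roots at [k] and [k'] opposite, yet both are nonnegative. *)
  move: Ek'; rewrite rr' srefl_sroot -Ek -linearN => /(can_inj (act_rev u)) Ek'.
  exfalso; apply: (@act_sroot_nonneg_excl p x); rewrite Ep pk -?Ek';
    by apply: plane_root_nonneg st Em _.
move=> retq endq; rewrite E /positive_word map_cat /= retract_cat endpoint_cat.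
rewrite -!/(positive_word _) retp endp /= /step loopx /= retq endq.
by split=> // z; rewrite !act_cat /= -!(act_cat u p) -upr sreflK act_cat.
Qed.


Lemma retract_standard u s t r r' k : r \in T -> r' \in T ->
  act u (sroot s) = sroot r -> act u (sroot t) = sroot r' ->
  retract u (positive_word (alt s t k)) = positive_word (alt r r' k) /\
  endpoint u (positive_word (alt s t k)) = u.
Proof.
elim: k s t r r' => // k IH s t r r' rT r'T us ut.
have -> : positive_word (alt s t k.+1) = (s, true) :: positive_word (alt t s k) by [].
have [E1 E2] := IH t s r' r r'T rT ut us.
have ls : loop u s = Some r by apply/loop_someP.
by rewrite /= /step ls /= E1 E2.
Qed.

Lemma positive_alt s t m : positive_word (alt s t m) = alternating s t m.
Proof.
rewrite /alternating; elim: m => // m IH.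
by rewrite altS /positive_word map_rcons [map _ _]IH mkseqS.
Qed.

(** Invariance of the form gives equal values of [h], hence equal labels by [dihedral_inj]. *)
Lemma coxeter_entry_transport u s t r r' : s != t -> r != r' ->
  act u (sroot s) = sroot r -> act u (sroot t) = sroot r' -> M r r' = M s t.
Proof.
move=> st rr' us ut; have := form_act u (sroot s) (sroot t).
rewrite us ut !form_sroot /cartan (negbTE st) (negbTE rr') => /oppr_inj Eh.
have D := dihedral_h rr'; rewrite Eh in D.
apply: dihedral_inj D (dihedral_h st) => m; exact: coxeter_ge2.
Qed.

Lemma retract_artin_rel u s t m : minimal u -> s != t -> M s t = Some m ->
  act (endpoint u (alternating s t m)) =1 act (endpoint u (alternating t s m)) /\
  pres_eq (artin_rel M) (retract u (alternating s t m))
                        (retract u (alternating t s m)).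
Proof.
move=> umin st Em; have ts : t != s by rewrite eq_sym.
have Em' : M t s = Some m by rewrite coxeter_sym.
rewrite -!positive_alt.
have [[r [r' [rT r'T us ut]]]|nstd] := pselect (plane_standard u s t).
  have [-> ->] := retract_standard m rT r'T us ut.
  have [-> ->] := retract_standard m r'T rT ut us.
  have rr' : r != r'.
    apply: contraNN st => /eqP rr'; apply/eqP/sroot_inj.
    by rewrite -(act_rev u (sroot s)) us rr' -ut act_rev.
  split=> //; rewrite !positive_alt; apply/PresRel; apply: ArtinRel => //.
  by rewrite -Em; apply: coxeter_entry_transport us ut.
have nstd' : ~ plane_standard u t s by move/plane_standard_sym.
have braid := act_braid st Em.
have [[k [r [km rT Ek]]]|no] := pselect (exists k r,
    [/\ (k < m)%N, r \in T & act u (plane_root s t k) = sroot r]).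
  have [-> Es] := retract_alt_some st Em umin nstd km rT Ek.
  (* The other side meets the same root at the mirrored position, counted from 0. *)
  have Ek' : act u (plane_root t s (m.-1 - k)) = sroot r.
    by rewrite (plane_root_sym st Em).
  have k'm : (m.-1 - k < m)%N by lia.
  have [-> Et] := retract_alt_some ts Em' umin nstd' k'm rT Ek'.
  split; last exact: PresRefl.
  by move=> x; rewrite Es Et !act_cat braid.
have [|-> ->] := @retract_alt_none u s t m st.
  by move=> k r km rT Ek; apply: no; exists k, r.
have [|-> ->] := @retract_alt_none u t s m ts.
  move=> k r km rT Ek; apply: no; exists (m.-1 - k)%N, r; split=> //; first by lia.
  by rewrite (plane_root_sym ts Em').
split; last exact: PresRefl.
by move=> x; rewrite !act_cat braid.
Qed.

Lemma minimal_nil : minimal [::].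
Proof. by move=> r _; exact: sroot_nonneg. Qed.

(** All minimal starts and the endpoints enter the induction because a concatenation resumes at the
    endpoint of its first factor. *)
Lemma retract_pres_eq (w w' : gword S) : pres_eq (artin_rel M) w w' ->
  forall u, minimal u -> act (endpoint u w) =1 act (endpoint u w') /\
    pres_eq (artin_rel M) (retract u w) (retract u w').
Proof.
elim=> {w w'} [w|w w' _ IH|w w' w'' _ IH _ IH'|v v' w w' _ IH _ IH'|s b|
  _ _ [s t m st Em]] u umin.
- by split=> //; exact: PresRefl.
- by have [E P] := IH u umin; split=> //; exact: PresSym.
- have [E P] := IH u umin; have [E' P'] := IH' u umin.
  by split=> [x|]; [rewrite E | exact: PresTrans P P'].
- have [E P] := IH u umin.
  have [E' P'] := IH' _ (minimal_endpoint v umin).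
  rewrite !endpoint_cat !retract_cat -(eq_retract w' E); split.
    by move=> x; rewrite E'; exact: eq_endpoint.
  exact: PresCat.
- rewrite /= /step; case ls: (loop u s) => [r|].
    by rewrite ls /=; split=> //; exact: PresCancel.
  (* A loop here would make the preimage of [sroot r] under [u] equal to [- sroot s], against
     minimality; so the second letter leads back to [u]. *)
  have -> : loop (rcons u s) s = None.
    case ls': (loop _ _) => [r|//]; have /loop_someP[rT] := ls'.
    rewrite act_rcons_sroot => us.
    have P := umin r rT; rewrite -us linearN /= act_rev in P.
    by case: (@act_sroot_nonneg_excl [::] s) => //=; exact: sroot_nonneg.
  split; last exact: PresRefl.
  by move=> x; rewrite !act_rcons sreflK.
- exact: retract_artin_rel.
Qed.

(** * Words on [T] and the length of the output *)

Definition word_on (w : gword S) := all (fun l => l.1 \in T) w.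

Lemma loop_nil s : s \in T -> loop [::] s = Some s.
Proof. by move=> sT; apply/loop_someP. Qed.

Lemma retract_id (w : gword S) : word_on w -> retract [::] w = w.
Proof. by elim: w => // -[s b] w IH /= /andP[sT wT]; rewrite /step loop_nil //= IH. Qed.

Lemma size_retract_le u (w : gword S) : (size (retract u w) <= size w)%N.
Proof.
elim: w u => // -[s b] w IH u /=; rewrite size_cat -add1n leq_add ?IH //.
by case: (loop u s).
Qed.

Lemma size_retract_lt (w : gword S) : ~~ word_on w ->
  (size (retract [::] w) < size w)%N.
Proof.
elim: w => // -[s b] w IH; rewrite /word_on /=.
have [sT wT|sT _] := boolP (s \in T).
  by rewrite /step loop_nil //= ltnS; exact: IH wT.
case ls: (loop [::] s) => [r|] /=; last by rewrite ltnS size_retract_le.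
by have /loop_someP[rT /sroot_inj sr] := ls; rewrite sr rT in sT.
Qed.

End Retraction.
End GeometricRepresentation.

Local Open Scope classical_set_scope.

(** * From words on [S] to words on the Artin generators *)

Section ArtinWords.
Context (S : finType) (M : coxeterMatrix S).

Definition gen_word (w : gword S) : gword (artin M) :=
  [seq (artin_gen M l.1, l.2) | l <- w].

Lemma gword_val_gen (w : gword S) :
  gword_val id (gen_word w) = pres_class (artin_rel M) w.
Proof.
by rewrite pres_classE /gword_val /gen_word big_map.
Qed.

Lemma expression_gen (a : artin M) (w : gword (artin M)) :
  expression (range (artin_gen M)) a w ->
  exists2 w', w = gen_word w' & a = pres_class (artin_rel M) w'.
Proof.
case=> wR <-.
suff [w' ->] : exists w', w = gen_word w' by exists w'; rewrite ?gword_val_gen.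
elim: w wR => [|[x b] w IH] wR; first by exists [::].
have [|w' ->] := IH; first by move=> l lw; apply: wR; rewrite inE lw orbT.
have [s _ /= sx] := wR _ (mem_head _ _).
by exists ((s, b) :: w'); rewrite /gen_word /= sx.
Qed.

Lemma generated_word_on (T : {set S}) (a : artin M) :
  generated (artin_gen M @` [set s | s \in T]) a ->
  exists2 w, word_on T w & a = pres_class (artin_rel M) w.
Proof.
move=> /(_ [set a | exists2 w, word_on T w & a = pres_class (artin_rel M) w]).
apply; split=> [|_ [s /= sT <-]].
  2: by exists [:: (s, true)]; rewrite // /word_on /= sT.
split=> [|_ _ [v vT ->] [w wT ->]|_ [w wT ->]].
- by exists [::].
- exists (v ++ w); first by rewrite /word_on all_cat [all _ v]vT.
  by rewrite -pres_mulE.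
- exists (gword_inv w); last by rewrite -pres_invgE.
  by rewrite /word_on /gword_inv all_rev all_map.
Qed.

End ArtinWords.

Theorem theorem1p2 (S : finType) (M : coxeterMatrix S) (T : {set S}) :
  convex_generated (range (artin_gen M)) (artin_gen M @` [set s | s \in T]).
Proof.
move=> a w /generated_word_on[v vT av] /geodesicP[].
move=> /expression_gen[{}w -> aw] shortest.
have [h dihedral_h] : exists h : option nat -> R,
    forall s t, s != t -> dihedral (M s t) (h (M s t)).
  (* Labels that do not occur between distinct vertices get the default value 0. *)
  have ex o : exists y : R, (exists s t, s != t /\ M s t = o) -> dihedral o y.
    have [[s [t [st <-]]]|no] := pselect (exists s t, s != t /\ M s t = o).
      2: by exists 0.
    by have [|y Dy] := @dihedral_exists (M s t); [move=> m; exact: coxeter_ge2 | exists y].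
  have [h hP] := choice ex.
  by exists h => s t st; apply: hP; exists s, t.
pose retr := retract M h T [::].
(* The word [v] on [T] is its own output, and [w] represents the same element as [v]. *)
have wr : pres_class (artin_rel M) (retr w) = a.
  rewrite av; apply/pres_classP; rewrite -(retract_id M h vT).
  apply: (retract_pres_eq dihedral_h _ (@minimal_nil _ _ _ _ _)).2.
  by apply/pres_classP; rewrite -aw.
have wT : word_on T w.
  (* Otherwise the output would be an expression of [a] shorter than the geodesic. *)
  apply/negPn/negP => /(size_retract_lt M h); apply/negP; rewrite -leqNgt.
  have := shortest (gen_word M (retr w)); rewrite !size_map; apply; split.
    by move=> _ /mapP[l _ ->]; exists l.1.
  by rewrite gword_val_gen.
by move=> _ /mapP[l lw ->]; exists l.1 => //; exact: (allP wT).
Qed.
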